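(* Let $(\mathcal{X},d)$ be a metric space, let $f>0$, let $t\ge 1$ be an integer, let $r>1$ and $h\in\mathbb{N}$ satisfy $r^h\ge 4t$, and let $k$ be a positive integer. Let $S$ be a finite multiset of points of $\mathcal{X}$, presented to the algorithm $\mathrm{OFL}(f)$ as a $t$-semirandom stream. Then the expected facility cost and the expected connection cost incurred by $\mathrm{OFL}(f)$ are each less than $(r+3)\,\mathrm{OPT}_k(S)+(h+2)fk$.
   Context: Online algorithm $\mathrm{OFL}(f)$ (Meyerson's online facility location algorithm): it maintains a set of open facilities, initially empty. When a point $p$ arrives, let $\delta(p)$ be the distance from $p$ to the nearest currently open facility ($\delta(p)=\infty$ if none is open). With probability $\min(1,\delta(p)/f)$ (independently of everything else) a facility is opened at $p$, at facility cost $f$; otherwise $p$ is connected to the nearest open facility, at connection cost $\delta(p)$. Facilities are never closed and connections are irrevocable. The facility cost incurred is $f$ times the number of facilities opened; the connection cost incurred is the sum of the connection costs paid. $t$-semirandom stream: for a multiset $S=\{p_1,\dots,p_n\}$, the points are first put in a uniformly random order $p_1,\dots,p_n$; then a $t$-bounded adversary outputs $p_{\sigma(1)},\dots,p_{\sigma(n)}$ for some permutation $\sigma$ (which may depend on the random order) satisfying $|\{j\in[n]: j<i \text{ and } \sigma(j)>\sigma(i)\}|<t$ for every $i\in[n]$. Bounds hold for every such adversary; expectations are over the random order and the algorithm's randomness. For a multiset $A\subset\mathcal{X}$ and a set $B\subset \mathcal{X}$, $\mathrm{COST}(A,B)=\sum_{a\in A}\min_{b\in B}d(a,b)$, and $\mathrm{OPT}_k(A)$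 is the minimum of $\mathrm{COST}(A,B)$ over all sets $B\subset\mathcal{X}$ of $k$ points. *)

(* Defs.v *)
From mathcomp Require Import all_boot all_order all_algebra all_fingroup.
From mathcomp Require Import finmap.
From mathcomp Require Import all_classical all_reals.
From mathcomp Require Import ereal topology metric_structure.

Set Implicit Arguments.
Unset Strict Implicit.
Unset Printing Implicit Defensive.

Import Order.TTheory GRing.Theory Num.Theory.
Local Open Scope ring_scope.

Section Clustering.
Context {R : realType} {X : metricType R}.

(* Distance from [x] to the nearest point of [B]; it is [+oo] if [B] is empty. *)
Definition nearest_dist (x : X) (B : seq X) : \bar R :=
  \big[Order.min/+oo%E]_(b <- B) (mdist x b)%:E.

(* Finite multisets of points are given by listings. *)
Definition COST (A : seq X) (B : {fset X}) : R :=
  \sum_(a <- A) fine (nearest_dist a B).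

(* The minimum over the [k]-point subsets of [X] is taken as an infimum, since
   it need not be attained in a general metric space. If [X] has fewer than
   [k > 0] points then the value is [inf set0 = 0], which is also the cost of
   taking all of [X] as the set of centers. *)
Definition OPT (k : nat) (A : seq X) : R :=
  inf [set COST A B | B in [set B : {fset X} | #|` B| = k]]%classic.

End Clustering.

(* A run of OFL([f]) on a stream [q] is determined by the set [W] of the
   positions [i] at which a facility is opened (at the point [q i]). *)
Section OnlineFacilityLocation.
Context {R : realType} {X : metricType R} {n : nat}.
Implicit Types (f : R) (q : 'I_n -> X) (W : {set 'I_n}).

Definition open_before q W (i : 'I_n) : seq X :=
  [seq q j | j : 'I_n <- enum W & (j < i)%N].

Definition delta q W (i : 'I_n) : \bar R :=
  nearest_dist (q i) (open_before q W i).

Definition open_prob f q W (i : 'I_n) : R :=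
  fine (Order.min 1 (delta q W i * f^-1%:E))%E.

(* The probability that exactly the positions in [W] open a facility. The coin
   tosses are fresh at each step, so by the chain rule this is the product of
   the probabilities of the successive decisions, each one computed from the
   facilities opened earlier in the run; all sets [W] are outcomes. *)
Definition run_prob f q W : R :=
  \prod_(i < n) (if i \in W then open_prob f q W i else 1 - open_prob f q W i).

Definition facility_cost f q W : R := f * #|W|%:R.

(* If no facility is open when [q i] arrives, then [i \notin W] has
   probability 0, so the value [fine +oo = 0] is irrelevant. *)
Definition connection_cost f q W : R :=
  \sum_(i < n | i \notin W) fine (delta q W i).

End OnlineFacilityLocation.

Definition t_bounded (t n : nat) (sigma : 'S_n) : Prop :=
  forall i : 'I_n,
    (#|[set j : 'I_n | (j < i)%N && (sigma i < sigma j)%N]| < t)%N.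

(* The multiset [S] is listed as [s_0, ..., s_(n-1)]. A uniformly random
   permutation [pi] yields the random order [p_i = s_(pi i)]; the adversary
   then outputs the stream [i |-> p_(sigma i)], where [sigma = adv pi]. *)
Definition stream {R : realType} {X : metricType R} {n : nat}
    (S : n.-tuple X) (adv : 'S_n -> 'S_n) (pi : 'S_n) : 'I_n -> X :=
  fun i => tnth S (pi (adv pi i)).

(* Expectation of [cost f q W] over the uniformly random order and, given this
   order, over the random decisions of OFL([f]). *)
Definition OFL_expectation {R : realType} {X : metricType R} {n : nat}
    (f : R) (S : n.-tuple X) (adv : 'S_n -> 'S_n)
    (cost : R -> ('I_n -> X) -> {set 'I_n} -> R) : R :=
  (n`!%:R)^-1 * \sum_(pi : 'S_n) \sum_(W : {set 'I_n})
     run_prob f (stream S adv pi) W * cost f (stream S adv pi) W.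

(* Main.v *)
Require Import Defs.
From mathcomp Require Import all_boot all_order all_algebra all_fingroup.
From mathcomp Require Import finmap.
From mathcomp Require Import all_classical all_reals.
From mathcomp Require Import ereal topology metric_structure.
From mathcomp Require Import ring lra zify.

Set Implicit Arguments.
Unset Strict Implicit.
Unset Printing Implicit Defensive.

Import Order.TTheory GRing.Theory Num.Theory.
Local Open Scope ring_scope.

(* Both costs are at most the sum of the expected tolls [min f (delta p)] over
   the stream.  Fix a set of centers and a cluster of m points around a center
   c, and let D be the distance from c to the open facilities, capped at f.  Let
   N be the m/3 points of the cluster farthest from c, P its other points, and
   rho the radius of P.  While [rho < D], the tolls on P cost f in total, since
   opening a point of P ends this phase; afterwards every point p of the cluster
   pays at most d(p,c) + rho.  A point p of N with [D <= r * d(p,c)] pays at most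
   (1 + r) * d(p,c).  The other points of N lower D by a factor r when they open:
   h such descents cost h * f in expectation and leave D below f/(4t), even
   below r/(4t) times the distance d of some descent point, whose budget
   (1 + r) * d is still unused.  As #|P| rho is at most twice the sum of d(p,c)
   over N plus three times that over P, all the terms in d(p,c) and rho add up to
   at most r + 3 times the sum of d(p,c) over the cluster.
   From then on, each toll on N is charged to an earlier toll on a subset G of P
   with 3/4 of the elements and at most 3/4 of the expected tolls on P.  The
   number of points of N with no available partner in G is at most 4t plus the
   excess over 3t + 1 of the walk that goes up at N and down at G along the
   random order (the adversary itself contributes at most t - 1 of them); the
   4t points use up the budget of the descent point, and by the ballot theorem
   the expected excess costs less than f/8. *)

(** * Maxima of random walks without replacement *)

(* For a walk going up at [Some true] and down at [Some false], the height by
   which its maximum exceeds [y] (0 if it does not). *)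
Fixpoint excess (y : nat) (l : seq (option bool)) : nat :=
  match l, y with
  | [::], _ => 0
  | None :: l', _ => excess y l'
  | Some false :: l', _ => excess y.+1 l'
  | Some true :: l', y'.+1 => excess y' l'
  | Some true :: l', 0 => (excess 0 l').+1
  end.

Lemma excess_prefix (y : nat) (l : seq (option bool)) (s : nat) :
  (count_mem (Some true) (take s l) <=
   count_mem (Some false) (take s l) + y + excess y l)%N.
Proof.
elim: l y s => [|x l IH] y [|s] //=.
case: x => [[]|] /=.
- case: y => [|y] /=; [have := IH 0%N s|have := IH y s];
    move: (count_mem _ _) (count_mem _ _) (excess _ _); lia.
- have := IH y.+1 s; move: (count_mem _ _) (count_mem _ _) (excess _ _); lia.
- exact: IH.
Qed.

(** Conditioning on the first entry [j] of a uniformly random order: what remains is a uniformly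
    random order of the other elements, enumerated by [lift j]. *)
Lemma sum_perm_first (V : nmodType) (T : Type) (n : nat) (c : 'I_n.+1 -> T)
    (F : seq T -> V) :
  \sum_(p : 'S_n.+1) F [seq c (p i) | i <- enum 'I_n.+1] =
  \sum_j \sum_(s : 'S_n) F (c j :: [seq c (lift j (s i)) | i <- enum 'I_n]).
Proof.
rewrite (partition_big (fun p : 'S_n.+1 => p ord0) xpredT) //=.
apply: eq_bigr => j _; rewrite (reindex (lift_perm ord0 j)) /=; last first.
  pose g (s : 'S_n.+1) k := odflt k (unlift (s ord0) (s (lift ord0 k))).
  have gK (s : 'S_n.+1) k : lift (s ord0) (g s k) = s (lift ord0 k).
    rewrite /g; have := neq_lift ord0 k.
    by rewrite -(inj_eq (@perm_inj _ s)) => /unlift_some[] ? ? ->.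
  have g_inj s : injective (g s).
    by move=> k k' /(congr1 (lift (s ord0))); rewrite !gK => /perm_inj/lift_inj.
  exists (fun s => perm (g_inj s)) => [s _|s].
    apply/permP => k; rewrite permE; apply: (@lift_inj _ (lift_perm ord0 j s ord0)).
    by rewrite gK lift_perm_lift lift_perm_id.
  rewrite inE => /eqP sj; apply/permP => k.
  case: (unliftP ord0 k) => [k'|] ->; last by rewrite lift_perm_id.
  by rewrite lift_perm_lift permE -[in LHS]sj gK.
apply: eq_big => [s|s _]; first by rewrite lift_perm_id eqxx.
rewrite enum_ordSl /= lift_perm_id -map_comp; congr (F (_ :: _)).
by apply: eq_map => i /=; rewrite lift_perm_lift.
Qed.

Section BallotTail.
Variable R : realFieldType.

(* By reflection, this is the probability that a uniformly random arrangement
   of [a] up-steps and [b >= a] down-steps has a partial sum at least [j]. *)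
Definition ballot_tail (a b j : nat) : R := (a ^_ j)%:R / ((b + j) ^_ j)%:R.

Lemma ballot_tail_ge0 a b j : 0 <= ballot_tail a b j.
Proof. by rewrite divr_ge0 ?ler0n. Qed.

Lemma ballot_tail_small a b j : (a < j)%N -> ballot_tail a b j = 0.
Proof. by move=> aj; rewrite /ballot_tail ffact_small // mul0r. Qed.

Lemma ffactDr_neq0 b j : ((b + j) ^_ j)%:R != 0 :> R.
Proof. by rewrite pnatr_eq0 -lt0n ffact_gt0 leq_addl. Qed.

(** First-step analysis: an up-step leaves level [j] to be reached, a down-step level [j + 2]. For
    [j < a] the two terms yield the factors [b + j + 1] and [a - j - 1], with sum [a + b]. The
    inequality may be strict when [b = 0], where the quotient can exceed 1. *)
Lemma ballot_tail_rec a b j :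
  a%:R * ballot_tail a.-1 b j + b%:R * ballot_tail a b.-1 j.+2
    <= (a + b)%:R * ballot_tail a b j.+1.
Proof.
have E1 : a%:R * ballot_tail a.-1 b j = (b + j.+1)%:R * ballot_tail a b j.+1.
  rewrite /ballot_tail addnS (ffactnS a) ffactSS !natrM.
  have w0 := ffactDr_neq0 b j; have b0 : (b + j).+1%:R != 0 :> R by rewrite pnatr_eq0.
  by field; rewrite w0 -natrD nat1r b0.
have E2 : b%:R * ballot_tail a b.-1 j.+2 <= (a - j.+1)%:R * ballot_tail a b j.+1.
  case: b {E1} => [|b] /=.
    by rewrite mul0r mulr_ge0 ?ler0n ?ballot_tail_ge0.
  rewrite /ballot_tail (ffactnSr a j.+1) (ffactnSr (b + j.+2) j.+1).
  have -> : (b + j.+2 - j.+1 = b.+1)%N by lia.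
  have -> : (b + j.+2 = b.+1 + j.+1)%N by lia.
  rewrite (natrM R (a ^_ j.+1)) (natrM R (_ ^_ j.+1) b.+1).
  have w0 := ffactDr_neq0 b.+1 j.+1.
  have b0 : b.+1%:R != 0 :> R by rewrite pnatr_eq0.
  move: (a ^_ j.+1)%:R ((b.+1 + j.+1) ^_ j.+1)%:R w0 => u w w0.
  by rewrite le_eqVlt; apply/orP; left; apply/eqP; field; rewrite w0 nat1r b0.
rewrite E1; apply: (le_trans (lerD (lexx _) E2)).
rewrite -mulrDl -natrD; case: (ltnP a j.+1) => aj.
  by rewrite ballot_tail_small // !mulr0.
by rewrite ler_wpM2r ?ballot_tail_ge0 // ler_nat; lia.
Qed.

(** The ratio of consecutive tails is [(a - j) / (b + j + 1) <= a / (b + 1) <= 2 / 3]. *)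
Lemma ballot_tail_geo a b j : (3 * a <= 2 * b.+1)%N ->
  ballot_tail a b j <= (2 / 3) ^+ j.
Proof.
move=> ab; elim: j => [|j IH]; first by rewrite /ballot_tail !ffactn0 divr1.
have -> : ballot_tail a b j.+1 =
    ballot_tail a b j * ((a - j)%:R / (b + j.+1)%:R).
  rewrite /ballot_tail ffactnSr addnS ffactSS !natrM invfM.
  by rewrite -!mulrA; congr (_ * _); rewrite mulrA mulrC.
rewrite exprSr ler_pM ?ballot_tail_ge0 ?divr_ge0 ?ler0n //.
rewrite ler_pdivrMr ?ltr0n ?addnS //.
suff : 3 * (a - j)%:R <= 2 * (b + j).+1%:R :> R by lra.
by rewrite -!natrM ler_nat; lia.
Qed.

(** Tail-sum formula for the expected excess over [y], with one term for each level from [y + 1] to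
    [y + N]. Levels above [a] contribute 0, so any [N >= a] captures all of them. *)
Definition ballot_sum (N y a b : nat) : R :=
  \sum_(i < N) ballot_tail a b (y + i).+1.

Lemma ballot_sum_ge0 N y a b : 0 <= ballot_sum N y a b.
Proof. by apply: sumr_ge0 => i _; exact: ballot_tail_ge0. Qed.

Lemma ballot_sum_recS N y a b :
  a%:R * ballot_sum N y a.-1 b + b%:R * ballot_sum N y.+2 a b.-1
    <= (a + b)%:R * ballot_sum N y.+1 a b.
Proof.
rewrite /ballot_sum !mulr_sumr -big_split /=; apply: ler_sum => i _.
by have := ballot_tail_rec a b (y + i).+1; rewrite !addSn.
Qed.

(** At the barrier an up-step adds 1 to the excess and leaves the barrier in place. This 1 is the
    tail at level 0, so the sum shifts by one level and [ballot_tail_rec] applies termwise; [a <= N]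
    makes the term lost at the top vanish. *)
Lemma ballot_sum_rec0 N a b : (a <= N)%N ->
  a%:R * (1 + ballot_sum N 0 a.-1 b) + b%:R * ballot_sum N 1 a b.-1
    <= (a + b)%:R * ballot_sum N 0 a b.
Proof.
move=> aN.
have [->|a0] := posnP a.
  rewrite mul0r add0r /ballot_sum big1 ?mulr0 => [|i _]; last first.
    by rewrite ballot_tail_small.
  by rewrite mulr_ge0 ?ler0n ?ballot_sum_ge0.
have -> : 1 + ballot_sum N 0 a.-1 b = \sum_(i < N) ballot_tail a.-1 b i.
  case: N aN => [|N] aN; first by lia.
  rewrite /ballot_sum big_ord_recr big_ord_recl /=.
  rewrite (@ballot_tail_small _ _ (0 + N).+1) ?addr0; last by lia.
  by congr (_ + _); rewrite /ballot_tail !ffactn0 divr1.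
rewrite /ballot_sum !mulr_sumr -big_split /=; apply: ler_sum => i _.
exact: ballot_tail_rec.
Qed.

Lemma ballot_sum_geo N y a b : (3 * a <= 2 * b.+1)%N ->
  ballot_sum N y a b <= 2 * (2 / 3) ^+ y.
Proof.
move=> ab.
apply: (@le_trans _ _ (\sum_(i < N) (2 / 3) ^+ (y + i).+1)).
  by apply: ler_sum => i _; exact: ballot_tail_geo.
have E : forall i : nat, (2 / 3 : R) ^+ (y + i).+1 =
  2 * (2 / 3) ^+ (y + i) - 2 * (2 / 3) ^+ (y + i.+1).
  by move=> i; rewrite addnS exprS; lra.
rewrite -(big_mkord xpredT (fun i => (2 / 3 : R) ^+ (y + i).+1)).
rewrite (@telescope_sumr_eq R 0 N (fun i => - (2 * (2 / 3) ^+ (y + i)))) //; last first.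
  by move=> i _; rewrite E; lra.
rewrite addn0 opprK addrC gerDl oppr_le0 mulr_ge0 // exprn_ge0 //; lra.
Qed.

Lemma excess_random_order (N n : nat) (c : 'I_n -> option bool) (y : nat) :
  (#|[set i | c i == Some true]| <= N)%N ->
  \sum_(p : 'S_n) (excess y [seq c (p i) | i <- enum 'I_n])%:R <=
  n`!%:R * ballot_sum N y #|[set i | c i == Some true]|
                          #|[set i | c i == Some false]|.
Proof.
elim: n c y => [|n IH] c y aN.
  rewrite big1 ?mulr_ge0 ?ler0n ?ballot_sum_ge0 // => p _.
  suff -> : enum 'I_0 = [::] by [].
  by apply: size0nil; rewrite size_enum_ord.
rewrite (sum_perm_first c (fun l => (excess y l)%:R)).
set a := #|[set i | c i == Some true]| in aN *.
set b := #|[set i | c i == Some false]|.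
have cardl j x : #|[set i | c (lift j i) == x]| =
    (#|[set i | c i == x]| - (c j == x))%N.
  rewrite -(card_imset _ (@lift_inj _ j)).
  have -> : [set lift j i | i in [set i | c (lift j i) == x]] =
            [set i | c i == x] :\ j.
    apply/finset.setP => i; rewrite !inE; apply/imsetP/andP => [[k]|[ij ci]].
      by rewrite inE => ck ->; rewrite eq_sym neq_lift.
    case: (unliftP j i) ij ci => [k -> _ ck|->]; last by rewrite eqxx.
    by exists k; rewrite ?inE.
  have := cardsD1 j [set i | c i == x]; rewrite inE => ->; lia.
(* [G x] bounds the mean excess given that the first colour is [x]. *)
pose G (x : option bool) : R := match x, y with
  | None, _ => ballot_sum N y a b
  | Some false, _ => ballot_sum N y.+1 a b.-1
  | Some true, 0 => 1 + ballot_sum N 0 a.-1 b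
  | Some true, y'.+1 => ballot_sum N y' a.-1 b
  end.
have H j : \sum_(s : 'S_n)
     (excess y (c j :: [seq c (lift j (s i)) | i <- enum 'I_n]))%:R
     <= n`!%:R * G (c j).
  have IHj z := IH (fun i => c (lift j i)) z.
  rewrite /= in IHj; rewrite !cardl -/a -/b in IHj.
  rewrite /G; case: (c j) IHj => [[]|] /=; rewrite ?subn0 ?subn1 => IHj.
  - case: y {G} => [|y]; last by apply: IHj; lia.
    under eq_bigr do rewrite -natr1 addrC.
    rewrite big_split /= sumr_const card_Sn mulrDr mulr1 lerD2l.
    by apply: IHj; lia.
  - exact: IHj.
  - exact: IHj.
apply: (le_trans (ler_sum _ (fun j _ => H j))).
rewrite -mulr_sumr factS mulnC natrM -mulrA ler_wpM2l ?ler0n //.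
(* [G] is affine in the indicators of the two colours, so its sum over [j] depends on the colouring
   only through [a] and [b]. *)
have GE j : G (c j) = G None + (c j == Some true)%:R * (G (Some true) - G None)
   + (c j == Some false)%:R * (G (Some false) - G None).
  by case: (c j) => [[]|] /=; rewrite ?mul1r ?mul0r; lra.
rewrite (eq_bigr _ (fun j _ => GE j)) !big_split /= sumr_const card_ord.
rewrite -!mulr_suml -!natr_sum.
have S x : (\sum_i (c i == x) = #|[set i | c i == x]|)%N.
  by rewrite -sum1dep_card [RHS]big_mkcond /=; apply: eq_bigr => i _; case: eqP.
rewrite !S -/a -/b -(mulr_natl (G None)).
rewrite -[in X in X <= _]/(G (Some true)) -[in X in X <= _]/(G (Some false)).
suff : a%:R * G (Some true) + b%:R * G (Some false) <= (a + b)%:R * G None.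
  rewrite -[ballot_sum N y a b]/(G None) natrD => ?; lra.
rewrite /G; case: (y) => [|z]; first exact: ballot_sum_rec0.
exact: ballot_sum_recS.
Qed.

End BallotTail.

(** * Independent coins and runs of the algorithm *)

Section CappedDistance.
Context {R : realType} {X : metricType R}.
Implicit Types (f : R) (x y : X) (B : seq X).

(** Starting the minimum at [f] keeps the distance real, with value [f] when nothing is open. It is
    also [f] times the opening probability of a point arriving at [x]. *)
Definition capped_dist f x B : R := \big[Order.min/f]_(b <- B) mdist x b.

Lemma capped_distE f x B :
  (capped_dist f x B)%:E = Order.min f%:E (nearest_dist x B).
Proof.
rewrite /capped_dist /nearest_dist; elim: B => [|b B IH].
  by rewrite !big_nil minEle leey.
by rewrite !big_cons EFin_min IH minCA.
Qed.

Lemma nearest_dist_ge0 x B : (0 <= nearest_dist x B)%E.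
Proof.
rewrite /nearest_dist; elim: B => [|b B IH]; first by rewrite big_nil leey.
by rewrite big_cons le_min IH lee_fin mdist_ge0.
Qed.

Lemma le_capped_dist f x B (v : R) :
  reflect (v <= f /\ forall b, b \in B -> v <= mdist x b) (v <= capped_dist f x B).
Proof.
rewrite /capped_dist; elim: B => [|b B IH].
  by rewrite big_nil; apply: (iffP idP) => [|[]].
rewrite big_cons le_min; apply: (iffP andP) => [[vb /IH[vf vB]]|[vf vB]].
  by split=> // b'; rewrite inE => /predU1P[->|/vB].
split; first by apply: vB; rewrite mem_head.
by apply/IH; split => // b' b'B; apply: vB; rewrite inE b'B orbT.
Qed.

Lemma capped_dist_le f x B : capped_dist f x B <= f.
Proof. by have /le_capped_dist[] := lexx (capped_dist f x B). Qed.

Lemma capped_dist_mem f x B b : b \in B -> capped_dist f x B <= mdist x b.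
Proof. by have /le_capped_dist[_] := lexx (capped_dist f x B); apply. Qed.

Lemma capped_dist_ge0 f x B : 0 < f -> 0 <= capped_dist f x B.
Proof. by move=> /ltW f0; apply/le_capped_dist; split => // b _; exact: mdist_ge0. Qed.

Lemma capped_dist_sub f x B B' :
  {subset B <= B'} -> capped_dist f x B' <= capped_dist f x B.
Proof.
move=> BB'; apply/le_capped_dist; split; first exact: capped_dist_le.
by move=> b /BB'; exact: capped_dist_mem.
Qed.

Lemma capped_dist_triangle f x y B :
  capped_dist f x B <= mdist x y + capped_dist f y B.
Proof.
rewrite -lerBlDl; apply/le_capped_dist; split.
  rewrite lerBlDl (le_trans (capped_dist_le _ _ _)) // lerDr; exact: mdist_ge0.
move=> b bB; rewrite lerBlDl; apply: (le_trans (capped_dist_mem f x bB)).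
exact: metric_triangle.
Qed.

End CappedDistance.

Section Coins.
Context {R : realType} {n : nat}.

(** Measurability with respect to the first [s] coin tosses. *)
Definition prefix_measurable (T : Type) (s : nat) (H : {set 'I_n} -> T) :=
  forall W W' : {set 'I_n},
    (forall j : 'I_n, (j < s)%N -> (j \in W) = (j \in W')) -> H W = H W'.

Variable pr : 'I_n -> {set 'I_n} -> R.
Hypothesis pr_meas : forall i : 'I_n, prefix_measurable i (pr i).

Let fac (i : 'I_n) (W : {set 'I_n}) : R := if i \in W then pr i W else 1 - pr i W.

Definition flip (i : 'I_n) (W : {set 'I_n}) : {set 'I_n} :=
  [set j | (j \in W) (+) (j == i)].

Lemma flipK i : involutive (flip i).
Proof. by move=> W; apply/finset.setP => j; rewrite !inE -addbA addbb addbF. Qed.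

Lemma in_flip i W : (i \in flip i W) = (i \notin W).
Proof. by rewrite inE eqxx addbT. Qed.

Lemma flip_meas T s (i : 'I_n) (H : {set 'I_n} -> T) W :
  (s <= i)%N -> prefix_measurable s H -> H (flip i W) = H W.
Proof.
move=> si; apply => j js; rewrite inE.
case: eqP => [ji|]; last by rewrite addbF.
by move: js; rewrite ji ltnNge si.
Qed.

Lemma fac_meas (i : 'I_n) : prefix_measurable i.+1 (fac i).
Proof.
move=> W W' WW'; rewrite /fac WW' //.
by rewrite (@pr_meas i W W') // => j ji; apply: WW'; rewrite ltnS ltnW.
Qed.

(** Flipping coin [i] swaps the weights [fac i] and [1 - fac i] and fixes [H]. So both weights give
    the same sum, and together they give the unweighted one. *)
Lemma sum_fac (i : 'I_n) (H : {set 'I_n} -> R) : prefix_measurable i H ->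
  \sum_W fac i W * H W = 2^-1 * \sum_W H W.
Proof.
move=> mH; have E : \sum_W fac i W * H W = \sum_W (1 - fac i W) * H W.
  rewrite (reindex_inj (inv_inj (flipK i))) /=; apply: eq_bigr => W _.
  rewrite (flip_meas W (leqnn i) mH) /fac in_flip (flip_meas W (leqnn i) (@pr_meas i)).
  by case: (i \in W); rewrite ?subKr.
suff : \sum_W fac i W * H W + \sum_W fac i W * H W = \sum_W H W by lra.
rewrite [in X in _ + X]E -big_split; apply: eq_bigr => W _ /=.
by rewrite -mulrDl addrC subrK mul1r.
Qed.

Lemma sum_fac_in (i : 'I_n) (H : {set 'I_n} -> R) : prefix_measurable i H ->
  \sum_(W : {set 'I_n}) (i \in W)%:R * H W = 2^-1 * \sum_W H W.
Proof.
move=> mH; have E : \sum_(W : {set 'I_n}) (i \in W)%:R * H W =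
    \sum_(W : {set 'I_n}) (i \notin W)%:R * H W.
  rewrite (reindex_inj (inv_inj (flipK i))) /=; apply: eq_bigr => W _.
  by rewrite (flip_meas W (leqnn i) mH) in_flip.
suff : \sum_(W : {set 'I_n}) (i \in W)%:R * H W +
    \sum_(W : {set 'I_n}) (i \in W)%:R * H W = \sum_W H W by lra.
rewrite [in X in _ + X]E -big_split; apply: eq_bigr => W _ /=; rewrite -mulrDl.
by case: (i \in W); rewrite ?addr0 ?add0r mul1r.
Qed.

(** Integrates out the coins from [s] on. The factor at [s] joins [H], which is then measurable one
    step later, and costs 1/2 against the counting measure by [sum_fac]. *)
Lemma sum_fac_tail k s (H : {set 'I_n} -> R) : (s + k = n)%N ->
  prefix_measurable s H ->
  \sum_W (\prod_(j < n | (s <= j)%N) fac j W) * H W = 2^-1 ^+ k * \sum_W H W.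
Proof.
elim: k s H => [|k IH] s H sk mH.
  rewrite mul1r; apply: eq_bigr => W _; rewrite big_pred0 ?mul1r // => j.
  by have := ltn_ord j; lia.
have sn : (s < n)%N by lia.
pose i := Ordinal sn.
have -> : \sum_W (\prod_(j < n | (s <= j)%N) fac j W) * H W =
   \sum_W (\prod_(j < n | (s.+1 <= j)%N) fac j W) * (fac i W * H W).
  apply: eq_bigr => W _; rewrite mulrA; congr (_ * _).
  rewrite (bigD1 i) //= mulrC; congr (_ * _); apply: eq_bigl => j.
  by rewrite -val_eqE /= ltn_neqAle eq_sym andbC.
rewrite IH; [|lia|]; first by rewrite (sum_fac (i := i) mH) mulrA -exprSr.
move=> W W' WW'; rewrite (@fac_meas i W W') // (mH W W') // => j js.
by apply: WW'; rewrite ltnS ltnW.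
Qed.

Definition coins_prob (W : {set 'I_n}) : R := \prod_(i < n) fac i W.

Lemma coins_prob_sum1 : \sum_W coins_prob W = 1.
Proof.
have := @sum_fac_tail n 0 (fun _ => 1) (add0n n) (fun _ _ _ => erefl).
under eq_bigr do rewrite mulr1.
rewrite /coins_prob => ->; rewrite sumr_const.
have -> : #|{: {set 'I_n}}| = (2 ^ n)%N.
  by rewrite -cardsT -powersetT card_powerset cardsT card_ord.
by rewrite natrX -exprMn mulVf ?expr1n // pnatr_eq0.
Qed.

Lemma coins_prob_in (i : 'I_n) (H : {set 'I_n} -> R) : prefix_measurable i H ->
  \sum_W coins_prob W * ((i \in W)%:R * H W) = \sum_W coins_prob W * (pr i W * H W).
Proof.
move=> mH.
have mP : prefix_measurable i (fun W => \prod_(j < n | (j < i)%N) fac j W).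
  move=> W W' WW'; apply: eq_bigr => j ji; apply: fac_meas => l lj.
  by apply: WW'; apply: leq_trans ji.
have mpr := @pr_meas i.
(* [K] collects what is decided before [i]. Both sides equal [2^-(n - i)] times its sum: on the
   left, the event [i \in W] turns [fac i] into [pr i]. *)
pose K W := (\prod_(j < n | (j < i)%N) fac j W) * (pr i W * H W).
have mK : prefix_measurable i K.
  by move=> W W' WW'; rewrite /K (mP W W') // (mpr W W') // (mH W W').
have split W : coins_prob W = (\prod_(j < n | (i <= j)%N) fac j W)
                             * (\prod_(j < n | (j < i)%N) fac j W).
  rewrite /coins_prob (bigID (fun j : 'I_n => (i <= j)%N)) /=; congr (_ * _).
  by apply: eq_bigl => j; rewrite -ltnNge.
have split' W : coins_prob W = (\prod_(j < n | (i.+1 <= j)%N) fac j W)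
               * (fac i W * (\prod_(j < n | (j < i)%N) fac j W)).
  rewrite split mulrA; congr (_ * _).
  rewrite (bigD1 i) //= mulrC; congr (_ * _); apply: eq_bigl => j.
  by rewrite -val_eqE /= ltn_neqAle eq_sym andbC.
transitivity (2^-1 ^+ (n - i) * \sum_W K W); last first.
  rewrite -(@sum_fac_tail _ i) ?subnKC // 1?ltnW //.
  by apply: eq_bigr => W _; rewrite split -mulrA.
transitivity (2^-1 ^+ (n - i.+1) * \sum_(W : {set 'I_n}) (i \in W)%:R * K W); last first.
  by rewrite sum_fac_in // mulrA -exprSr subnSK.
rewrite -(@sum_fac_tail _ i.+1) ?subnKC //.
  apply: eq_bigr => W _; rewrite split' -!mulrA; congr (_ * _).
  by rewrite /K /fac; case: (i \in W); rewrite ?mul0r ?mulr0 ?mul1r // mulrCA.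
move=> W W' WW'; rewrite WW' // (mK W W') // => j ji.
by apply: WW'; rewrite ltnS ltnW.
Qed.

Lemma coins_prob_ge0 W : (forall i, 0 <= pr i W <= 1) -> 0 <= coins_prob W.
Proof.
move=> pr01; apply: prodr_ge0 => i _; rewrite /fac.
by have /andP[p0 p1] := pr01 i; case: ifP => _ //; rewrite subr_ge0.
Qed.

End Coins.

Section Runs.
Context {R : realType} {X : metricType R} {n : nat}.
Variables (f : R) (q : 'I_n -> X).
Hypothesis f_gt0 : 0 < f.
Implicit Types (W : {set 'I_n}) (i j : 'I_n) (s : nat).

Definition opened W s : seq X := [seq q j | j : 'I_n <- enum W & (j < s)%N].

Lemma mem_opened W j s : j \in W -> (j < s)%N -> q j \in opened W s.
Proof. by move=> jW js; apply/map_f; rewrite mem_filter js mem_enum. Qed.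

Lemma opened_sub W s s' : (s <= s')%N -> {subset opened W s <= opened W s'}.
Proof.
move=> ss' x /mapP[j]; rewrite mem_filter mem_enum => /andP[js jW] ->.
by apply: mem_opened => //; apply: leq_trans ss'.
Qed.

Lemma opened_meas s : prefix_measurable s (opened^~ s).
Proof.
move=> W W' WW'; rewrite /opened /enum_mem -!filter_predI; congr map.
apply: eq_filter => j /=; case: (ltnP j s) => //= js.
by have := WW' _ js.
Qed.

Lemma deltaE W i : delta q W i = nearest_dist (q i) (opened W i).
Proof. by []. Qed.

Definition toll W i : R := capped_dist f (q i) (opened W i).

Lemma toll_ge0 W i : 0 <= toll W i.
Proof. exact: capped_dist_ge0. Qed.

Lemma toll_le W i : toll W i <= f.
Proof. exact: capped_dist_le. Qed.

Lemma toll_meas i : prefix_measurable i (toll^~ i).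
Proof. by move=> W W' WW'; rewrite /toll (opened_meas WW'). Qed.

Lemma open_probE W i : open_prob f q W i = toll W i / f.
Proof.
rewrite /open_prob deltaE /toll.
have := capped_distE f (q i) (opened W i).
case: (nearest_dist _ _) => [x| |] /=.
- rewrite -EFin_min -EFinM -EFin_min => -[->] /=.
  by rewrite (minr_pMl _ _ (ltW _)) ?invr_gt0 // divff // gt_eqF.
- rewrite mulyr gtr0_sg ?invr_gt0 // mul1e !minEle !leey => -[->] /=.
  by rewrite divff // gt_eqF.
- by rewrite minEle leeNy_eq.
Qed.

Lemma open_prob01 W i : 0 <= open_prob f q W i <= 1.
Proof.
by rewrite open_probE divr_ge0 ?toll_ge0 ?(ltW f_gt0) //= ler_pdivrMr // mul1r toll_le.
Qed.

Lemma open_prob_meas i : prefix_measurable i ((open_prob f q)^~ i).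
Proof. by move=> W W' WW'; rewrite !open_probE (toll_meas WW'). Qed.

Definition run_mean (F : {set 'I_n} -> R) : R := \sum_W run_prob f q W * F W.

Lemma run_prob_ge0 W : 0 <= run_prob f q W.
Proof.
apply: (@coins_prob_ge0 _ _ (fun i W => open_prob f q W i)) => i.
exact: open_prob01.
Qed.

Lemma run_mean_le F G : (forall W, F W <= G W) -> run_mean F <= run_mean G.
Proof. by move=> FG; apply: ler_sum => W _; rewrite ler_wpM2l ?run_prob_ge0. Qed.

Lemma run_mean_cst (c : R) : run_mean (fun=> c) = c.
Proof.
rewrite /run_mean -mulr_suml.
have -> : \sum_W run_prob f q W = 1 := coins_prob_sum1 open_prob_meas.
by rewrite mul1r.
Qed.

Lemma run_meanD F G : run_mean (fun W => F W + G W) = run_mean F + run_mean G.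
Proof. by rewrite /run_mean -big_split; apply: eq_bigr => W _; rewrite mulrDr. Qed.

Lemma run_meanZ c F : run_mean (fun W => c * F W) = c * run_mean F.
Proof. by rewrite /run_mean mulr_sumr; apply: eq_bigr => W _; rewrite mulrCA. Qed.

Lemma run_mean_sum (I : finType) (P : pred I) (F : I -> {set 'I_n} -> R) :
  run_mean (fun W => \sum_(i | P i) F i W) = \sum_(i | P i) run_mean (F i).
Proof.
by rewrite /run_mean exchange_big; apply: eq_bigr => W _; rewrite mulr_sumr.
Qed.

(** Trades expected tolls for expected openings, the opening probability being [toll / f]. Any
    weight [H] known before the coin at [i] is tossed may be carried along. *)
Lemma run_mean_toll i (H : {set 'I_n} -> R) : prefix_measurable i H ->
  run_mean (fun W => toll W i * H W) = f * run_mean (fun W => (i \in W)%:R * H W).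
Proof.
move=> mH; rewrite /run_mean.
have -> := coins_prob_in open_prob_meas mH.
rewrite mulr_sumr; apply: eq_bigr => W _; rewrite [RHS]mulrCA; congr (_ * _) => /=.
by rewrite open_probE mulrA [f * _]mulrC divfK // gt_eqF.
Qed.

Lemma run_mean_facility :
  run_mean (facility_cost f q) = run_mean (fun W => \sum_i toll W i).
Proof.
rewrite run_mean_sum /facility_cost run_meanZ.
have -> : run_mean (fun W => #|W|%:R) = run_mean (fun W => \sum_i (i \in W)%:R * 1).
  apply: eq_bigr => W _; rewrite -sum1_card natr_sum big_mkcond /=.
  by congr (_ * _); apply: eq_bigr => i _; case: (i \in W); rewrite mulr1.
rewrite run_mean_sum mulr_sumr; apply: eq_bigr => i _.
by rewrite -run_mean_toll //; apply: eq_bigr => W _; rewrite mulr1.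
Qed.

(** With opening probability [p], the conditional connection cost [(1 - p) * delta] is 0 when
    [delta >= f], as then [p = 1], and at most [delta] otherwise. *)
Lemma run_mean_connection :
  run_mean (connection_cost f q) <= run_mean (fun W => \sum_i toll W i).
Proof.
have -> : run_mean (connection_cost f q) =
    run_mean (fun W => \sum_i (i \notin W)%:R * fine (delta q W i)).
  apply: eq_bigr => W _; congr (_ * _); rewrite /connection_cost big_mkcond /=.
  by apply: eq_bigr => i _; case: (i \in W); rewrite ?mul0r ?mul1r.
rewrite !run_mean_sum; apply: ler_sum => i _.
have md : prefix_measurable i (fun W => fine (delta q W i)).
  by move=> W W' WW'; rewrite !deltaE (opened_meas WW').
have -> : run_mean (fun W => (i \notin W)%:R * fine (delta q W i)) =
    run_mean (fun W => (1 - open_prob f q W i) * fine (delta q W i)).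
  transitivity (run_mean (fun W => fine (delta q W i)) -
                run_mean (fun W => (i \in W)%:R * fine (delta q W i))).
    rewrite /run_mean -sumrB; apply: eq_bigr => W _.
    by rewrite -mulrBr; case: (i \in W); rewrite ?mul0r ?mul1r ?subrr ?subr0.
  rewrite {2}/run_mean (coins_prob_in open_prob_meas md) /run_mean -sumrB.
  by apply: eq_bigr => W _; rewrite -mulrBr mulrBl mul1r.
apply: run_mean_le => W; rewrite open_probE /toll.
have := capped_distE f (q i) (opened W i); rewrite deltaE.
have := nearest_dist_ge0 (q i) (opened W i).
case: (nearest_dist _ _) => [x| |] //=; last first.
  by move=> _ _; rewrite mulr0 capped_dist_ge0.
rewrite lee_fin => x0; rewrite -EFin_min => -[->].
have [fx|xf] := leP f x; first by rewrite divff ?gt_eqF // subrr mul0r ltW.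
by rewrite mulrBl mul1r gerBl !mulr_ge0 ?invr_ge0 ?(ltW f_gt0).
Qed.

End Runs.

(** * Charging the tolls of one run *)

Definition before {n : nat} (A : {set 'I_n}) (s : nat) : nat :=
  #|[set i in A | (i < s)%N]|.

Lemma beforeS {n : nat} (A : {set 'I_n}) (i : 'I_n) :
  before A i.+1 = ((i \in A) + before A i)%N.
Proof.
rewrite /before (cardsD1 i) !inE ltnSn andbT; congr (_ + #|pred_of_set _|)%N.
apply/finset.setP => j; rewrite !inE ltnS leq_eqVlt -val_eqE /=.
by case: eqVneq => [->|_]; rewrite ?ltnn ?andbF.
Qed.

Lemma before0 {n : nat} (A : {set 'I_n}) : before A 0 = 0%N.
Proof. by apply/eqP; rewrite cards_eq0; apply/eqP/finset.setP => j; rewrite !inE andbF. Qed.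

Lemma before_sub {n : nat} (A B : {set 'I_n}) s :
  A \subset B -> (before A s <= before B s)%N.
Proof.
move=> /fintype.subsetP AB; apply/subset_leq_card/fintype.subsetP => i.
by rewrite !inE => /andP[/AB-> ->].
Qed.

(* Summation by parts: each element of [E] is matched to an earlier element of
   [G], where the weight was at least as large, except for [L] of them. *)
Lemma sum_nonincreasing_matching (R : realDomainType) (n L : nat) (z : R)
    (x : nat -> R) (E G : {set 'I_n}) :
  (forall s s', (s <= s')%N -> x s' <= x s) ->
  (forall s, 0 <= x s) -> 0 <= z ->
  (forall i, i \in E -> x i <= z) ->
  (forall s, (before E s <= before G s + L)%N) ->
  [disjoint E & G] ->
  \sum_(i in E) x i <= \sum_(i in G) x i + z * L%:R.
Proof.
move=> x_mono x_ge0 z_ge0 xz EG dEG; pose y s := Order.min (x s) z.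
have y_mono s : y s.+1 <= y s.
  by rewrite le_min !ge_min lexx orbT andbT x_mono.
have y_ge0 s : 0 <= y s by rewrite le_min x_ge0.
have yx s : y s <= x s by rewrite ge_min lexx.
(* [K s] counts the partners still free at time [s], [L] of them granted in advance at price [z].
   Each is worth the current truncated weight [y s], which equals [x s] whenever an element of [E]
   uses one up. *)
pose K s := (before G s + L - before E s)%N.
have main s : (s <= n)%N ->
   \sum_(i in E | (i < s)%N) x i + (K s)%:R * y s <=
   \sum_(i in G | (i < s)%N) x i + z * L%:R.
  elim: s => [_|s IH sn].
    rewrite !big1; [|by move=> i; rewrite andbF|by move=> i; rewrite andbF].
    by rewrite !add0r /K !before0 subn0 mulrC ler_wpM2r // ge_min lexx orbT.
  have {}IH := IH (ltnW sn); pose i := Ordinal sn.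
  have split (A : {set 'I_n}) : \sum_(j in A | (j < s.+1)%N) x j =
     (i \in A)%:R * x s + \sum_(j in A | (j < s)%N) x j.
    case iA: (i \in A); last first.
      rewrite mul0r add0r; apply: eq_bigl => j; rewrite ltnS leq_eqVlt.
      by case: (eqVneq (j : nat) s) => //= js; rewrite (_ : j = i) ?iA //; exact: val_inj.
    rewrite mul1r (bigD1 i) ?iA ?ltnSn //=; congr (_ + _); apply: eq_bigl => j.
    by rewrite -andbA ltnS -val_eqE /= [(_ < s)%N]ltn_neqAle [((j : nat) != _) && _]andbC.
  rewrite !split; have := EG s.+1.
  have /= bE := beforeS E i; have /= bG := beforeS G i.
  rewrite bE bG /K bE bG.
  have EGi : ~~ ((i \in E) && (i \in G)).
    by apply/negP => /andP[/(disjointFr dEG)->].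
  have := y_mono s; have := y_ge0 s.+1; have := yx s.
  have := xz i; have := EG s; rewrite /=.
  case: (i \in E) EGi; case: (i \in G) => //= _.
  - move=> EGs /(_ isT) xsz ys y0 yS K1.
    have ysE : y s = x s by rewrite /y min_l.
    move: IH; rewrite mul1r mul0r add0r /K.
    have -> : (before G s + L - before E s =
      (0 + before G s + L - (1 + before E s)).+1)%N by lia.
    set k := (_ - _)%N; rewrite -natr1 ysE mulrDl mul1r => IH.
    by have : k%:R * y s.+1 <= k%:R * x s; [rewrite ler_wpM2l // -ysE|lra].
  - move=> EGs _ ys y0 yS K1; move: IH; rewrite mul0r add0r mul1r /K.
    have -> : (1 + before G s + L - (0 + before E s) =
      (before G s + L - before E s).+1)%N by lia.
    set k := (_ - _)%N; rewrite -natr1 mulrDl mul1r => IH.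
    by have : k%:R * y s.+1 <= k%:R * y s; [rewrite ler_wpM2l|lra].
  - move=> EGs _ ys y0 yS K1; move: IH; rewrite !mul0r !add0r /K.
    set k := (_ - _)%N => IH.
    by have : k%:R * y s.+1 <= k%:R * y s; [rewrite ler_wpM2l|lra].
have := main n (leqnn n).
rewrite (eq_bigl (mem E)); last by move=> j; rewrite ltn_ord andbT.
rewrite [X in _ <= X + _](eq_bigl (mem G)); last by move=> j; rewrite ltn_ord andbT.
by apply: le_trans; rewrite lerDl mulr_ge0.
Qed.

Lemma card_first_le {n : nat} (J : {set 'I_n}) (h : nat) :
  (#|[set i in J | before J i < h]| <= h)%N.
Proof.
set D := [set i in J | _].
(* The second inequality makes room for the first: a new element of [D] has
   [before D <= before J < h]. *)
have main s : (s <= n)%N -> (before D s <= h)%N && (before D s <= before J s)%N.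
  elim: s => [|s IH] sn; first by rewrite !before0.
  have /andP[Dh DJ] := IH (ltnW sn).
  have /= -> := beforeS D (Ordinal sn); have /= -> := beforeS J (Ordinal sn).
  rewrite inE /=; case: (_ \in J) => /=; last by rewrite !add0n Dh.
  by case: ltnP => Jh; rewrite ?add0n ?add1n ?ltnS ?DJ ?Dh ?andbT; lia.
have /andP[] := main n (leqnn n).
rewrite /before (_ : [set i in D | _] = D) //.
by apply/finset.setP => i; rewrite !inE ltn_ord andbT.
Qed.

Section Descents.
Variables (R : realFieldType) (n : nat) (f r rho : R) (N : {set 'I_n}).
Variables (d : 'I_n -> R) (D : nat -> R).

(* [D i] is the (capped) distance from the center to the open facilities. *)
Definition steep (i : 'I_n) : bool :=
  [&& i \in N, rho < D i, r * d i < D i & (1 + r) * d i < f].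

Definition descents (W : {set 'I_n}) : {set 'I_n} := [set i in W | steep i].

(** With [D] determined by the past, the condition is decided before the coin at [i], so that
    [run_mean_toll] can trade the tolls of these points for openings, at most [h] in each run. *)
Definition early_steep (W : {set 'I_n}) (h : nat) (i : 'I_n) : bool :=
  steep i && (before (descents W) i < h)%N.

End Descents.

Section Pathwise.
Variables (R : realFieldType) (n h t x : nat) (f r rho : R).
Variables (d v : 'I_n -> R) (D : nat -> R) (N P G W : {set 'I_n}).
Hypotheses (f_gt0 : 0 < f) (r_gt1 : 1 < r) (t_gt0 : (0 < t)%N).
Hypothesis rh_ge4t : 4 * t%:R <= r ^+ h.
Hypothesis rho_ge0 : 0 <= rho.
Hypothesis D_mono : forall s s', (s <= s')%N -> D s' <= D s.
Hypothesis D_ge0 : forall s, 0 <= D s.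
Hypothesis D_open : forall i : 'I_n, i \in W -> D i.+1 <= d i.
Hypothesis v_ge0 : forall i, 0 <= v i.
Hypothesis v_le : forall i : 'I_n, v i <= d i + D i.
Hypothesis v_lef : forall i, v i <= f.
Hypothesis v_ge : forall i : 'I_n, D i <= d i + v i.
Hypothesis N_far : forall i, i \in N -> rho <= d i.
Hypothesis P_close : forall i, i \in P -> d i <= rho.
Hypothesis GP : G \subset P.
Hypothesis NP : [disjoint N & P].
Hypothesis NG : forall s, (before N s <= before G s + (4 * t + x))%N.

Let J := descents f r rho N d D W.
Let cand := early_steep f r rho N d D W h.
Let y (s : nat) : R := Num.max 0 (D s - rho).
Let E := [set i | steep f r rho N d D i & (h <= before J i)%N].

Lemma early_descents : \sum_(i | cand i) (i \in W)%:R <= h%:R :> R.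
Proof.
have H := card_first_le J h.
rewrite -natr_sum ler_nat; apply: leq_trans H.
rewrite -sum1_card [leqRHS]big_mkcond [leqLHS]big_mkcond /=.
apply: leq_sum => i _; rewrite !inE /cand /early_steep -/J.
by case: (i \in W) => //=; case: ifP.
Qed.

(** The witness is the first descent [j]: it brings [D] down to [d j], and each later descent
    divides [D] by at least [r]. One factor [r] stays on the right because the first descent is
    compared with [d j] itself. *)
Lemma descents_geometric s : (s <= n)%N -> (0 < before J s)%N ->
  exists2 j, j \in J & (j < s)%N /\ r ^+ before J s * D s <= r * d j.
Proof.
elim: s => [|s IH] sn; first by rewrite before0.
have {}IH := IH (ltnW sn); pose i := Ordinal sn.
have r0 : 0 <= r by rewrite ltW // (lt_trans _ r_gt1).
have /= -> := beforeS J i; case iJ: (i \in J); last first.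
  move=> /IH[j jJ [js H]]; exists j => //; split; first by rewrite ltnS ltnW.
  apply: le_trans H; rewrite add0n ler_wpM2l ?exprn_ge0 //; exact: D_mono.
move=> _; move: (iJ); rewrite inE => /andP[iW /and4P[_ _ rd _]].
have Di : D s.+1 <= d i := D_open iW.
case: (posnP (before J s)) => [->|/IH[j jJ [js H]]].
  by exists i => //; split=> //; rewrite expr1 ler_wpM2l.
exists j => //; split; first by rewrite ltnS ltnW.
apply: le_trans H; rewrite add1n exprSr -mulrA ler_wpM2l ?exprn_ge0 //.
by apply: (le_trans _ (ltW rd)); rewrite ler_wpM2l.
Qed.

(** If [i] is not steep, then [D i <= rho <= d i], [D i <= r * d i] or [f <= (1 + r) * d i], and
    each of these keeps the toll within the budget. A late steep point pays at most
    [d i + rho <= 2 * d i], and [y i] on top. *)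
Lemma far_toll i : i \in N -> ~~ cand i ->
  v i <= (1 + r) * d i + (i \in E)%:R * y i.
Proof.
move=> iN; have := N_far iN; have := v_le i; have := v_lef i.
have di : 0 <= d i := le_trans rho_ge0 (N_far iN).
have rdi : d i <= r * d i by rewrite ler_peMl // ltW.
rewrite /cand /early_steep -/J /E inE; case st: (steep _ _ _ _ _ _ _) => /=.
  rewrite -leqNgt => vf vd dr ->; rewrite mul1r.
  have : D i - rho <= y i by rewrite le_max lexx orbT.
  lra.
move: st; rewrite /steep iN /= => /negbT; rewrite !negb_and -!leNgt => /or3P st vf vd dr _.
by rewrite mul0r addr0; case: st => ?; lra.
Qed.

Lemma late_steep_toll :
  \sum_(i in E) y i <= \sum_(i in N | cand i) (1 + r) * d i +
    \sum_(i in G | rho < D i) v i + f / (4 * t%:R) * x%:R.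
Proof.
have r0 : 0 <= r by rewrite ltW // (lt_trans _ r_gt1).
have dN i : i \in N -> 0 <= d i by move=> iN; exact: le_trans (N_far iN).
have t0 : 0 < 4 * t%:R :> R by rewrite mulr_gt0 ?ltr0n.
have [->|[i1 i1E]] := set_0Vmem E.
  rewrite big_set0 !addr_ge0 //.
  - by apply: sumr_ge0 => i /andP[iN _]; rewrite mulr_ge0 ?dN ?addr_ge0.
  - by apply: sumr_ge0.
  - by rewrite mulr_ge0 ?ler0n ?divr_ge0 ?(ltW t0) ?(ltW f_gt0).
(* The first late steep point. At least [h] descents precede it and, by minimality, each of them is
   early; so the budget of the descent [j] found below is not spent in [far_toll]. *)
pose i0 := [arg min_(i < i1 in E) (i : nat)].
have [i0E i0min] : i0 \in E /\ forall j, j \in E -> (i0 <= j)%N.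
  by rewrite /i0; case: arg_minnP.
have /andP[st0 hJ0] : steep f r rho N d D i0 && (h <= before J i0)%N.
  by move: i0E; rewrite inE.
have h0 : (0 < h)%N.
  case: (h) rh_ge4t => //; rewrite expr0 => H.
  have : 1 <= t%:R :> R by rewrite ler1n.
  lra.
have [j jJ [ji0 Dj]] := descents_geometric (ltnW (ltn_ord i0)) (leq_trans h0 hJ0).
move: (jJ); rewrite inE => /andP[jW jst].
have /and4P[jN _ _ jf] := jst.
have jcand : cand j.
  rewrite /cand /early_steep jst /= ltnNge; apply/negP => hJj.
  have /i0min : j \in E by rewrite inE jst.
  by rewrite leqNgt ji0.
(* Price of an unmatched point, from [4 * t * D i0 <= r ^ h * D i0 <= r * d j]. Then [4 * t] such
   points cost [r * d j], and since [(1 + r) * d j < f] by steepness, each of the [x] others costs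
   at most [f / (4 * t)]. *)
pose z := r * d j / (4 * t%:R).
have z0 : 0 <= z by rewrite divr_ge0 ?(ltW t0) // mulr_ge0 // dN.
have yz i : i \in E -> y i <= z.
  move=> iE; rewrite ge_max z0 /= (@le_trans _ _ (D i0)) //.
    by have := D_mono (i0min _ iE); have := rho_ge0; lra.
  rewrite /z ler_pdivlMr // mulrC (le_trans _ Dj) // ler_wpM2r //.
  by rewrite (le_trans rh_ge4t) // ler_weXn2l // ltW.
have EN : E \subset N by apply/fintype.subsetP => i; rewrite inE => /andP[/and4P[]].
have EG : [disjoint E & G].
  by rewrite (disjointWl EN) // (disjointWr GP).
have := @sum_nonincreasing_matching R n (4 * t + x) z y E G _ _ z0 yz _ EG.
have H1 s s' : (s <= s')%N -> y s' <= y s.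
  move=> ss'; rewrite ge_max !le_max lexx /= lerD2r D_mono ?orbT //.
have H2 s : 0 <= y s by rewrite le_max lexx.
have H3 s : (before E s <= before G s + (4 * t + x))%N.
  exact: leq_trans (before_sub s EN) (NG s).
move=> /(_ H1 H2 H3) H; apply: (le_trans H).
have Gy : \sum_(i in G) y i <= \sum_(i in G | rho < D i) v i.
  rewrite big_mkcondr; apply: ler_sum => i iG.
  rewrite ge_max; case: ltP => rD; rewrite ?v_ge0 ?lexx /= ?subr_le0 //.
  by have := v_ge i; have := P_close (fintype.subsetP GP _ iG); lra.
have Nd : (1 + r) * d j <= \sum_(i in N | cand i) (1 + r) * d i.
  rewrite (bigD1 j) ?jN //= lerDl sumr_ge0 // => i /andP[/andP[iN _] _].
  by rewrite mulr_ge0 ?dN ?addr_ge0.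
have zt : z * (4 * t)%:R = r * d j by rewrite natrM divfK // gt_eqF.
have zf : z * x%:R <= f / (4 * t%:R) * x%:R.
  rewrite ler_wpM2r ?ler0n // ler_wpM2r ?invr_ge0 ?(ltW t0) //.
  by have := dN _ jN; lra.
rewrite natrD mulrDr zt; have := dN _ jN; lra.
Qed.

(** The first summand stands in for the tolls on [cand], with which it agrees in the mean. The
    budget of a point of [N] outside [cand] pays for its own toll; the budgets inside [cand] pay for
    late steep points. *)
Lemma pathwise_bound :
  f * (\sum_(i | cand i) (i \in W)%:R) + \sum_(i in N | ~~ cand i) v i +
    \sum_(i in P | D i <= rho) v i <=
  h%:R * f + (1 + r) * (\sum_(i in N) d i) + \sum_(i in P) (d i + rho) +
    \sum_(i in G | rho < D i) v i + f / (4 * t%:R) * x%:R.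
Proof.
have H1 : f * (\sum_(i | cand i) (i \in W)%:R) <= h%:R * f.
  by rewrite mulrC ler_wpM2r ?early_descents // ltW.
have H2 : \sum_(i in P | D i <= rho) v i <= \sum_(i in P) (d i + rho).
  rewrite big_mkcondr; apply: ler_sum => i iP.
  case: ifP => [Di|_]; first by have := v_le i; lra.
  by have := v_le i; have := v_ge i; have := rho_ge0; lra.
have H3 : \sum_(i in N | ~~ cand i) v i <=
   \sum_(i in N | ~~ cand i) (1 + r) * d i + \sum_(i in E) y i.
  have -> : \sum_(i in E) y i = \sum_(i in N | ~~ cand i) (i \in E)%:R * y i.
    rewrite big_mkcond [RHS]big_mkcond /=; apply: eq_bigr => i _.
    rewrite /cand /early_steep -/J /E inE; case st: (steep _ _ _ _ _ _ _) => /=.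
      have /and4P[-> _ _ _] := st; rewrite -leqNgt.
      by case: ifP => //; rewrite mul1r.
    by rewrite mul0r; case: ifP.
  by rewrite -big_split /=; apply: ler_sum => i /andP[]; exact: far_toll.
have H4 := late_steep_toll.
have H5 : (1 + r) * (\sum_(i in N) d i) = \sum_(i in N | cand i) (1 + r) * d i +
  \sum_(i in N | ~~ cand i) (1 + r) * d i by rewrite mulr_sumr -bigID.
rewrite H5; lra.
Qed.

End Pathwise.

(** * Expected tolls of one cluster *)

Section Stream.
Context {R : realType} {X : metricType R} {n : nat}.
Variables (f r rho : R) (h t x : nat) (q : 'I_n -> X) (c : X).
Variables (N P G : {set 'I_n}).
Let d i : R := mdist (q i) c.

Definition center_dist (W : {set 'I_n}) (s : nat) : R := capped_dist f c (opened q W s).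

Hypotheses (f_gt0 : 0 < f) (r_gt1 : 1 < r) (t_gt0 : (0 < t)%N).
Hypothesis rh_ge4t : 4 * t%:R <= r ^+ h.
Hypothesis rho_ge0 : 0 <= rho.
Hypothesis N_far : forall i, i \in N -> rho <= d i.
Hypothesis P_close : forall i, i \in P -> d i <= rho.
Hypothesis GP : G \subset P.
Hypothesis NP : [disjoint N & P].
Hypothesis NG : forall s, (before N s <= before G s + (4 * t + x))%N.

Lemma center_dist_mono (W : {set 'I_n}) s s' :
  (s <= s')%N -> center_dist W s' <= center_dist W s.
Proof. by move=> ss'; apply/capped_dist_sub/opened_sub. Qed.

Lemma center_dist_open (W : {set 'I_n}) i : i \in W -> center_dist W i.+1 <= d i.
Proof.
by move=> iW; rewrite /d metric_sym; apply/capped_dist_mem/mem_opened.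
Qed.

Lemma center_dist_meas s : prefix_measurable s (center_dist^~ s).
Proof. by move=> W W' WW'; rewrite /center_dist (opened_meas q WW'). Qed.

Lemma early_steep_meas (i : 'I_n) : prefix_measurable i
  (fun W => early_steep f r rho N d (center_dist W) W h i).
Proof.
have mst (j : 'I_n) s : (j <= s)%N ->
    prefix_measurable s (fun W => steep f r rho N d (center_dist W) j).
  move=> js W W' WW'; rewrite /steep (@center_dist_meas j W W') // => l lj.
  by apply/WW'/(leq_trans lj).
move=> W W' WW'; rewrite /early_steep (mst i i (leqnn i) _ _ WW'); congr (_ && (_ < _)%N).
apply: eq_card => j; rewrite !inE; case: (ltnP j i); rewrite ?andbF // !andbT => ji.
by rewrite (WW' _ ji) (mst j i (ltnW ji) _ _ WW').
Qed.

(** In each run at most one point of [P] opens while [rho < center_dist], since its opening puts a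
    facility within [rho] of the center; [run_mean_toll] converts this into tolls. *)
Lemma run_mean_core :
  run_mean f q (fun W => \sum_(i in P | rho < center_dist W i) toll f q W i) <= f.
Proof.
have -> : run_mean f q (fun W => \sum_(i in P | rho < center_dist W i) toll f q W i) =
   f * run_mean f q (fun W => \sum_(i in P) (i \in W)%:R * (rho < center_dist W i)%R%:R).
  transitivity (run_mean f q (fun W =>
      \sum_(i in P) toll f q W i * (rho < center_dist W i)%R%:R)).
    apply: eq_bigr => W _; rewrite big_mkcondr; congr (_ * _).
    by apply: eq_bigr => i _; case: ifP; rewrite ?mulr1 ?mulr0.
  rewrite !run_mean_sum mulr_sumr; apply: eq_bigr => i _.
  apply: (run_mean_toll q f_gt0) => W W' WW' /=.
  by rewrite (@center_dist_meas i W W').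
rewrite ler_piMr ?(ltW f_gt0) // -[leRHS](run_mean_cst q f_gt0) run_mean_le // => W.
pose K := [set i in P | (i \in W) && (rho < center_dist W i)].
have -> : \sum_(i in P) (i \in W)%:R * (rho < center_dist W i)%R%:R = #|K|%:R :> R.
  rewrite -sum1_card natr_sum big_mkcond [RHS]big_mkcond /=; apply: eq_bigr => i _.
  by rewrite inE; case: (i \in P) => //=; rewrite -natrM mulnb; case: (_ && _).
rewrite -[leRHS]/(1%:R) ler_nat; apply/card_le1_eqP.
have H i j : i \in K -> j \in K -> ~~ (i < j)%N.
  rewrite !inE => /and3P[iP iW _] /and3P[_ _ jr]; apply/negP => ij.
  have := center_dist_mono W ij; have := center_dist_open iW; have := P_close iP.
  by move: jr; lra.
move=> i j iK jK; apply/val_inj/eqP; rewrite eqn_leq.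
by rewrite leqNgt H //= leqNgt H.
Qed.

Lemma run_mean_cluster :
  run_mean f q (fun W => \sum_(i in N) toll f q W i + \sum_(i in P) toll f q W i) <=
  f + h%:R * f + (1 + r) * (\sum_(i in N) d i) + \sum_(i in P) (d i + rho) +
  run_mean f q (fun W => \sum_(i in G | rho < center_dist W i) toll f q W i) +
  f / (4 * t%:R) * x%:R.
Proof.
pose cand (W : {set 'I_n}) i := early_steep f r rho N d (center_dist W) W h i.
pose A (W : {set 'I_n}) := \sum_(i in P | rho < center_dist W i) toll f q W i.
pose B (W : {set 'I_n}) := \sum_(i in P | center_dist W i <= rho) toll f q W i.
pose B' (W : {set 'I_n}) := \sum_(i in N | ~~ cand W i) toll f q W i.
pose C (W : {set 'I_n}) : R := f * (\sum_(i | cand W i) (i \in W)%:R).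
pose C' (W : {set 'I_n}) := \sum_(i | cand W i) toll f q W i.
have -> : run_mean f q (fun W => \sum_(i in N) toll f q W i + \sum_(i in P) toll f q W i)
    = run_mean f q A + run_mean f q (fun W => C' W + (B' W + B W)).
  rewrite -run_meanD; apply: eq_bigr => W _; congr (_ * _).
  rewrite (bigID (cand W) (mem N)) /=.
  rewrite (bigID (fun i : 'I_n => rho < center_dist W i) (mem P)) /=.
  have -> : \sum_(i in N | cand W i) toll f q W i = C' W.
    apply: eq_bigl => i; rewrite /cand /early_steep /steep.
    by case: (i \in N).
  have -> : \sum_(i in P | ~~ (rho < center_dist W i)) toll f q W i = B W.
    by apply: eq_bigl => i; rewrite -leNgt.
  by rewrite -/(A W) -/(B' W); ring.
(* The tolls [C'] of the early steep points become [f] times their openings, which [pathwise_bound]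
   controls run by run. *)
have -> : run_mean f q (fun W => C' W + (B' W + B W)) =
          run_mean f q (fun W => C W + B' W + B W).
  rewrite !run_meanD addrA; congr (_ + _ + _); rewrite /C run_meanZ.
  transitivity (run_mean f q (fun W => \sum_i toll f q W i * (cand W i)%:R)).
    apply: eq_bigr => W _; congr (_ * _); rewrite /C' big_mkcond /=.
    by apply: eq_bigr => i _; case: ifP; rewrite ?mulr1 ?mulr0.
  transitivity (f * run_mean f q (fun W => \sum_i (i \in W)%:R * (cand W i)%:R)).
    rewrite !run_mean_sum mulr_sumr; apply: eq_bigr => i _.
    apply: (run_mean_toll q f_gt0) => W W' WW' /=.
    by rewrite /cand (early_steep_meas WW').
  congr (_ * _); apply: eq_bigr => W _; congr (_ * _); rewrite [RHS]big_mkcond /=.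
  by apply: eq_bigr => i _; case: ifP; rewrite ?mulr1 ?mulr0.
have HA := run_mean_core.
have HB : run_mean f q (fun W => C W + B' W + B W) <=
  run_mean f q (fun W => (h%:R * f + (1 + r) * (\sum_(i in N) d i) +
     \sum_(i in P) (d i + rho) + f / (4 * t%:R) * x%:R) +
     \sum_(i in G | rho < center_dist W i) toll f q W i).
  apply: (run_mean_le q f_gt0) => W.
  have := @pathwise_bound R n h t x f r rho d (toll f q W) (center_dist W) N P G W.
  move=> /(_ f_gt0 r_gt1 t_gt0 rh_ge4t rho_ge0 (center_dist_mono W)).
  move=> /(_ (fun s => capped_dist_ge0 _ _ f_gt0) (@center_dist_open W)).
  move=> /(_ (toll_ge0 q f_gt0 W)).
  have H1 i : toll f q W i <= d i + center_dist W i by exact: capped_dist_triangle.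
  have H2 (i : 'I_n) : center_dist W i <= d i + toll f q W i.
    by rewrite /d metric_sym; exact: capped_dist_triangle.
  move=> /(_ H1 (toll_le f q W) H2 N_far P_close GP NP NG).
  rewrite -/(cand W) -/(B' W) -/(B W) -/(C W); lra.
apply: (le_trans (lerD HA HB)).
rewrite run_meanD (run_mean_cst q f_gt0); lra.
Qed.

End Stream.

Lemma take_enum_ord (n u : nat) :
  take u (enum 'I_n) = [seq i : 'I_n <- enum 'I_n | (i < u)%N].
Proof.
apply: (inj_map val_inj); rewrite map_take.
transitivity [seq i <- [seq val i | i <- enum 'I_n] | (i < u)%N]; last first.
  by rewrite filter_map.
rewrite val_enum_ord.
case: (leqP u n) => un.
  rewrite take_iota (minn_idPl un) -(@filter_iota_ltn 0 n u un).
  by apply: eq_filter => i; rewrite add0n.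
rewrite take_oversize ?size_iota ?(ltnW un) //; apply/esym/all_filterP/allP => i.
by rewrite mem_iota add0n /= => /leq_trans; apply; exact: ltnW.
Qed.

Lemma count_take_enum_ord (n u : nat) (T : eqType) (F : 'I_n -> T) (y : T) (A : {set 'I_n}) :
  (forall i, (F i == y) = (i \in A)) ->
  count_mem y (take u [seq F i | i <- enum 'I_n]) = before A u.
Proof.
move=> FA; rewrite -map_take count_map take_enum_ord count_filter -sum1_count big_enum_cond.
by rewrite /before -sum1_card; apply: eq_bigl => i; rewrite !inE /= FA.
Qed.

(* Here [u] is the smallest rank not output before time [s]: when it is output,
   fewer than [t] larger ranks have been output. *)
Lemma t_bounded_before (t n : nat) (sigma : 'S_n) (s : nat) : t_bounded t sigma ->
  (0 < t)%N ->
  exists u, forall A : {set 'I_n},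
    (before A u <= before (sigma @^-1: A) s)%N /\
    (before (sigma @^-1: A) s < before A u + t)%N.
Proof.
move=> tb t0; pose U := [set j : 'I_n | (s <= (sigma^-1)%g j)%N].
have sub u (A : {set 'I_n}) : (forall j : 'I_n, (j < u)%N -> j \notin U) ->
    (before A u <= before (sigma @^-1: A) s)%N.
  move=> uU; rewrite /before -(card_imset _ (@perm_inj _ sigma^-1%g)).
  apply/subset_leq_card/fintype.subsetP => i /imsetP[j]; rewrite !inE => /andP[jA ju] ->.
  by rewrite permKV jA ltnNge; have := uU j ju; rewrite inE.
have [U0|[m1 m1U]] := set_0Vmem U.
  exists n => A; split; first by apply: sub => j _; rewrite U0 inE.
  rewrite -addn1 leq_add // /before -(card_imset _ (@perm_inj _ sigma)).
  apply/subset_leq_card/fintype.subsetP => i /imsetP[j]; rewrite !inE => /andP[jA js] ->.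
  by rewrite jA ltn_ord.
pose m := [arg min_(j < m1 in U) (j : nat)].
have [mU mmin] : m \in U /\ forall j, j \in U -> (m <= j)%N.
  by rewrite /m; case: arg_minnP.
exists m => A; split.
  by apply: sub => j jm; apply/negP => /mmin; rewrite leqNgt jm.
pose a := (sigma^-1)%g m; have sa : (s <= a)%N by move: mU; rewrite inE.
have := tb a; rewrite permKV => card_t.
apply: (@leq_ltn_trans (before A m +
    #|[set j : 'I_n | (j < a)%N && (m < sigma j)%N]|)); last by rewrite ltn_add2l.
rewrite /before -(card_imset [set i in A | _] (@perm_inj _ sigma^-1%g)).
apply: leq_trans (leq_card_setU _ _); apply/subset_leq_card/fintype.subsetP => i.
rewrite !inE => /andP[iA is']; case: (ltngtP (sigma i) m) => im.
- by apply/orP; left; apply/imsetP; exists (sigma i); rewrite ?permK // inE iA.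
- by rewrite (leq_trans is' sa) orbT.
- have ia : i = a by rewrite /a -(val_inj im) permK.
  by move: is'; rewrite ia ltnNge sa.
Qed.

Lemma farthest_subset (R : realDomainType) (T : finType) (A : {set T}) (w : T -> R)
    (m : nat) : (m <= #|A|)%N ->
  exists B : {set T}, [/\ B \subset A, #|B| = m &
    forall a b, a \in A :\: B -> b \in B -> w a <= w b].
Proof.
elim: m => [_|m IH mA].
  by exists finset.set0; rewrite finset.sub0set cards0; split => // a b _; rewrite inE.
have [B [BA Bm Bw]] := IH (ltnW mA).
have [a0 a0AB] : exists a0, a0 \in A :\: B.
  by apply/finset.set0Pn; rewrite -card_gt0 cardsD (finset.setIidPr BA) Bm subn_gt0.
have [e eAB emax] : exists2 e, e \in A :\: B & forall a, a \in A :\: B -> w a <= w e.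
  by case: (@arg_maxP _ _ _ a0 (mem (A :\: B)) w a0AB) => e; exists e.
have [eA eB] : e \in A /\ e \notin B by move: eAB; rewrite inE => /andP[].
exists (e |: B); split.
- by apply/fintype.subsetP => a; rewrite !inE => /predU1P[->//|/(fintype.subsetP BA)].
- by rewrite cardsU1 eB Bm.
- move=> a b; rewrite !inE negb_or => /andP[/andP[_ aB] aA].
  by move=> /predU1P[->|bB]; [apply: emax|apply: Bw]; rewrite // inE aB.
Qed.

(** Averaging: [B] consists of the [m] smallest weights, and each of them is compared with each
    weight outside [B]. *)
Lemma light_subset (R : realDomainType) (T : finType) (A : {set T}) (w : T -> R)
    (m : nat) : (m <= #|A|)%N ->
  exists B : {set T}, [/\ B \subset A, #|B| = m &
    #|A|%:R * (\sum_(i in B) w i) <= m%:R * (\sum_(i in A) w i)].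
Proof.
move=> mA; have [B [BA Bm Bw]] := @farthest_subset R T A (fun i => - w i) m mA.
exists B; split => //.
have H : #|A :\: B|%:R * (\sum_(i in B) w i) <= #|B|%:R * (\sum_(i in A :\: B) w i).
  rewrite !mulr_sumr -[leLHS]/(\sum_(i in B) #|A :\: B|%:R * w i).
  rewrite (eq_bigr (fun i => \sum_(j in A :\: B) w i)); last first.
    by move=> i _; rewrite sumr_const mulr_natl.
  rewrite [leRHS](eq_bigr (fun i => \sum_(j in B) w i)); last first.
    by move=> i _; rewrite sumr_const mulr_natl.
  rewrite [leRHS]exchange_big; apply: ler_sum => b bB; apply: ler_sum => a aAB.
  by have := Bw a b aAB bB; rewrite lerN2.
have -> : #|A| = (#|B| + #|A :\: B|)%N.
  by rewrite cardsD (finset.setIidPr BA) subnKC // subset_leq_card.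
rewrite [in leRHS](big_setID B) /= (finset.setIidPr BA) -Bm natrD mulrDl mulrDr lerD2l.
exact: H.
Qed.

(** [N] is the farthest third of [A], rounded down, and [rho] the maximum of [w] on [P]. So
    [#|N| * rho] is at most the sum over [N], [rho] at most the sum over [P], and the rounding costs
    at most three copies of [rho]. *)
Lemma core_split (R : realFieldType) (T : finType) (A : {set T}) (w : T -> R) :
  (0 < #|A|)%N -> (forall a, 0 <= w a) ->
  exists (N P : {set T}) (rho : R),
    [/\ N :|: P = A, [disjoint N & P], (2 * #|N| <= #|P|)%N & (0 < #|P|)%N] /\
    [/\ 0 <= rho, forall a, a \in N -> rho <= w a, forall a, a \in P -> w a <= rho &
      #|P|%:R * rho <= 2 * (\sum_(a in N) w a) + 3 * (\sum_(a in P) w a)].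
Proof.
move=> A0 w0; have mA : (#|A| %/ 3 <= #|A|)%N by exact: leq_div.
have [N [NA Nm Nw]] := farthest_subset w mA.
pose P := A :\: N.
have Pm : #|P| = (#|A| - #|A| %/ 3)%N by rewrite cardsD (finset.setIidPr NA) Nm.
have P0 : (0 < #|P|)%N by rewrite Pm; lia.
have [a0 a0P] : exists a, a \in P by apply/finset.set0Pn; rewrite -card_gt0.
have [e eP emax] : exists2 e, e \in P & forall a, a \in P -> w a <= w e.
  by case: (@arg_maxP _ _ _ a0 (mem P) w a0P) => e; exists e.
exists N, P, (w e); split; split => //.
- by rewrite -[RHS](finset.setID A N) (finset.setIidPr NA).
- by rewrite -setI_eq0 finset.setIDA finset.setDIl finset.setDv finset.set0I.
- by rewrite Pm Nm; lia.
- by move=> a aN; exact: Nw.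
have HN : #|N|%:R * w e <= \sum_(a in N) w a.
  by rewrite mulr_natl -sumr_const; apply: ler_sum => a aN; exact: Nw.
have HP : w e <= \sum_(a in P) w a.
  by rewrite (bigD1 e) //= lerDl sumr_ge0.
have : #|P|%:R <= 2 * #|N|%:R + 3 :> R.
  by rewrite -natrM -natrD ler_nat Pm Nm; lia.
move/(ler_wpM2r (w0 e)); rewrite mulrDl -mulrA; lra.
Qed.

Section Cluster.
Context {R : realType} {X : metricType R}.
Variables (f r : R) (h t n : nat) (S : n.-tuple X) (adv : 'S_n -> 'S_n).
Hypotheses (f_gt0 : 0 < f) (r_gt1 : 1 < r) (t_gt0 : (0 < t)%N).
Hypothesis rh_ge4t : 4 * t%:R <= r ^+ h.
Hypothesis adv_bounded : forall p, t_bounded t (adv p).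

Let tau (p : 'S_n) : 'S_n := (adv p * p)%g.
Let q p := stream S adv p.

Lemma streamE p i : q p i = tnth S (tau p i).
Proof. by rewrite /tau permM. Qed.

Lemma sum_stream p (A : {set 'I_n}) (F : 'I_n -> R) :
  \sum_(i in tau p @^-1: A) F (tau p i) = \sum_(e in A) F e.
Proof.
by rewrite [RHS](reindex_inj (@perm_inj _ (tau p))); apply: eq_bigl => i; rewrite inE.
Qed.

Definition colour (N G : {set 'I_n}) (e : 'I_n) : option bool :=
  if e \in N then Some true else if e \in G then Some false else None.

(** The barrier [3 * t + 1] and the at most [t - 1] points contributed by the adversary add up to
    the [4 * t] of [before_stream]. *)
Definition stream_excess (N G : {set 'I_n}) (p : 'S_n) : nat :=
  excess (3 * t + 1) [seq colour N G (p j) | j <- enum 'I_n].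

Lemma before_stream (N G : {set 'I_n}) p s : [disjoint N & G] ->
  (before (tau p @^-1: N) s <=
   before (tau p @^-1: G) s + (4 * t + stream_excess N G p))%N.
Proof.
move=> NG; have [u Hu] := t_bounded_before s (adv_bounded p) t_gt0.
have comp (A : {set 'I_n}) : tau p @^-1: A = adv p @^-1: (p @^-1: A).
  by apply/finset.setP => i; rewrite !inE permM.
have [_ HN] := Hu (p @^-1: N); have [HG _] := Hu (p @^-1: G).
have := excess_prefix (3 * t + 1) [seq colour N G (p j) | j <- enum 'I_n] u.
rewrite -/(stream_excess N G p).
rewrite (@count_take_enum_ord _ _ _ _ _ (p @^-1: N)); last first.
  by move=> i; rewrite inE /colour; case: (p i \in N); case: (p i \in G).
rewrite (@count_take_enum_ord _ _ _ _ _ (p @^-1: G)); last first.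
  move=> i; rewrite inE /colour; case: (boolP (p i \in N)) => [iN|_].
    by rewrite (disjointFr NG iN).
  by case: (p i \in G).
by rewrite !comp; lia.
Qed.

Section OneCluster.
Variables (c : X) (A : {set 'I_n}).
Let w e := mdist (tnth S e) c.

(** The multiples of [f] are 1 for the tolls on [P] while [rho] is below the center distance, [h]
    for the descents, 3/4 for the tolls on [G] and 1/8 for the excess. *)
Lemma cluster_bound :
  \sum_(p : 'S_n) run_mean f (q p) (fun W => \sum_(i in tau p @^-1: A) toll f (q p) W i)
  <= n`!%:R * ((r + 3) * (\sum_(e in A) w e) + (h%:R + 15 / 8) * f).
Proof.
have w_ge0 e : 0 <= w e by exact: mdist_ge0.
have [A0|A_gt0] := posnP #|A|.
  move: A0 => /eqP; rewrite cards_eq0 => /eqP ->.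
  rewrite big1 => [|p _]; last first.
    rewrite /run_mean big1 // => W _; rewrite big1 ?mulr0 // => i.
    by rewrite !inE.
  by rewrite big_set0 mulr0 add0r !mulr_ge0 ?(ltW f_gt0).
have [N [P [rho [[NPA NP cNP P0] [rho0 Nfar Pclose Prho]]]]] := core_split A_gt0 w_ge0.
pose alive p W (i : 'I_n) := rho < center_dist f (q p) c W i.
(* Summing over all orders makes [m] a function of the point alone. Hence [G] is chosen
   independently of the order, and the walk coloured by [N] and [G] is uniformly random. *)
pose m e := \sum_(p : 'S_n) run_mean f (q p) (fun W =>
  (alive p W ((tau p)^-1%g e))%:R * toll f (q p) W ((tau p)^-1%g e)).
have mE (B : {set 'I_n}) : \sum_(e in B) m e = \sum_(p : 'S_n) run_mean f (q p) (fun W =>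
    \sum_(i in tau p @^-1: B | alive p W i) toll f (q p) W i).
  rewrite exchange_big; apply: eq_bigr => p _; rewrite -run_mean_sum.
  apply: eq_bigr => W _; congr (_ * _); rewrite big_mkcondr.
  rewrite -(sum_stream p B (fun e => (alive p W ((tau p)^-1%g e))%:R *
     toll f (q p) W ((tau p)^-1%g e))).
  by apply: eq_bigr => i _; rewrite permK; case: (alive p W i); rewrite ?mul1r ?mul0r.
have sumSn (x : R) : \sum_(p : 'S_n) x = n`!%:R * x.
  by rewrite sumr_const card_Sn mulr_natl.
have Pclose' p i : i \in tau p @^-1: P -> mdist (q p i) c <= rho.
  by rewrite inE streamE => /Pclose.
have Nfar' p i : i \in tau p @^-1: N -> rho <= mdist (q p i) c.
  by rewrite inE streamE => /Nfar.
have mP : \sum_(e in P) m e <= n`!%:R * f.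
  rewrite mE -sumSn; apply: ler_sum => p _.
  by apply: (@run_mean_core _ _ _ f rho (q p) c _ f_gt0 (Pclose' p)).
have [G [GP Gm Gw]] : exists G : {set 'I_n}, [/\ G \subset P, #|G| = ((3 * #|P|) %/ 4)%N &
    #|P|%:R * (\sum_(e in G) m e) <= ((3 * #|P|) %/ 4)%:R * (\sum_(e in P) m e)].
  by apply: light_subset; clear; lia.
have mG : \sum_(e in G) m e <= n`!%:R * (3 / 4 * f).
  have P0' : 0 < #|P|%:R :> R by rewrite ltr0n.
  rewrite -(ler_pM2l P0') (le_trans Gw) //.
  apply: (@le_trans _ _ ((3 / 4 * #|P|%:R) * (n`!%:R * f))); last by lra.
  apply: ler_pM => //.
  - apply: sumr_ge0 => e _; apply: sumr_ge0 => p _; apply: sumr_ge0 => W _.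
    by rewrite mulr_ge0 ?run_prob_ge0 // mulr_ge0 ?toll_ge0.
  - suff : 4 * ((3 * #|P|) %/ 4)%:R <= 3 * #|P|%:R :> R by lra.
    by rewrite -!natrM ler_nat mulnC leq_divM.
have NG : [disjoint N & G] by exact: disjointWr GP NP.
have excess_sum : \sum_(p : 'S_n) (stream_excess N G p)%:R <= n`!%:R * (32 / 81) :> R.
  have cN : [set e | colour N G e == Some true] = N.
    by apply/finset.setP => e; rewrite inE /colour; case: (e \in N); case: (e \in G).
  have cG : [set e | colour N G e == Some false] = G.
    apply/finset.setP => e; rewrite inE /colour; case: (boolP (e \in N)) => [eN|_].
      by rewrite (disjointFr NG eN).
    by case: (e \in G).
  apply: (le_trans (@excess_random_order R #|N| n (colour N G) _ _)); rewrite cN //.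
  rewrite cG ler_wpM2l //; apply: (le_trans (ballot_sum_geo _ _ _ _)).
    (* [3 * #|N| <= 3 / 2 * #|P| < 2 * (#|G| + 1)], where the 1 absorbs the rounding in [#|G|]. *)
    by rewrite Gm; clear -cNP; move: #|N| #|P| cNP => a b ab; lia.
  have : (2 / 3) ^+ (3 * t + 1) <= (2 / 3 : R) ^+ 4.
    by apply: ler_wiXn2l; [lra|lra|clear -t_gt0; lia].
  by rewrite (_ : (2 / 3 : R) ^+ 4 = 16 / 81); [lra|field].
have main p : run_mean f (q p) (fun W => \sum_(i in tau p @^-1: A) toll f (q p) W i) <=
   (f + h%:R * f + (1 + r) * (\sum_(e in N) w e) + \sum_(e in P) (w e + rho)) +
   run_mean f (q p) (fun W => \sum_(i in tau p @^-1: G | alive p W i) toll f (q p) W i) +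
   f / (4 * t%:R) * (stream_excess N G p)%:R.
  have GP' : tau p @^-1: G \subset tau p @^-1: P by exact: preimsetS.
  have NP' : [disjoint tau p @^-1: N & tau p @^-1: P].
    apply/pred0P => i /=; rewrite !inE; apply/negP => /andP[iN iP].
    by rewrite (disjointFr NP iN) in iP.
  have := @run_mean_cluster R X n f r rho h t _ (q p) c _ _ _ f_gt0 r_gt1 t_gt0
    rh_ge4t rho0 (Nfar' p) (Pclose' p) GP' NP' (fun s => before_stream p s NG).
  rewrite -(sum_stream p N w) -(sum_stream p P (fun e => w e + rho)).
  have E1 : \sum_(i in tau p @^-1: N) mdist (q p i) c = \sum_(i in tau p @^-1: N) w (tau p i).
    by apply: eq_bigr => i _; rewrite streamE.
  have E2 : \sum_(i in tau p @^-1: P) (mdist (q p i) c + rho) =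
            \sum_(i in tau p @^-1: P) (w (tau p i) + rho).
    by apply: eq_bigr => i _; rewrite streamE.
  rewrite E1 E2; apply: le_trans; rewrite le_eqVlt; apply/orP; left; apply/eqP.
  apply: eq_bigr => W _; congr (_ * _); rewrite -bigU //=.
  by apply: eq_bigl => i; rewrite -NPA !inE.
apply: (le_trans (ler_sum _ (fun p _ => main p))).
rewrite 2!big_split /= -mulr_sumr -mE sumSn.
have HT : \sum_(e in A) w e = \sum_(e in N) w e + \sum_(e in P) w e.
  by rewrite -bigU //; apply: eq_bigl => e; rewrite -NPA inE.
have HP : \sum_(e in P) (w e + rho) = \sum_(e in P) w e + #|P|%:R * rho.
  by rewrite big_split /= sumr_const mulr_natl.
(* The mean excess is at most [2 * (2 / 3) ^ 4 = 32 / 81], the barrier being at least 4, and a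
   quarter of this is below 1/8. *)
have Hx : f / (4 * t%:R) * (\sum_(p : 'S_n) (stream_excess N G p)%:R) <=
    n`!%:R * (1 / 8 * f).
  apply: (@le_trans _ _ (f / 4 * (n`!%:R * (32 / 81)))).
    apply: ler_pM => //.
    - by rewrite divr_ge0 ?(ltW f_gt0).
    - exact: sumr_ge0.
    - rewrite ler_wpM2l ?(ltW f_gt0) // lef_pV2 ?posrE ?mulr_gt0 ?ltr0n //.
      by have : 1 <= t%:R :> R; [rewrite ler1n|lra].
  have : 0 <= n`!%:R * f by rewrite mulr_ge0 ?(ltW f_gt0).
  lra.
have HN0 : 0 <= \sum_(e in N) w e by exact: sumr_ge0.
have HP0 : 0 <= \sum_(e in P) w e by exact: sumr_ge0.
have rP : \sum_(e in P) w e <= r * \sum_(e in P) w e by rewrite ler_peMl // ltW.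
(* [#|P| * rho] adds 2 to the coefficient on [N] and 3 to that on [P], which become [r + 3] and
   [4 <= r + 3]. *)
have HTT : (1 + r) * (\sum_(e in N) w e) + \sum_(e in P) (w e + rho) <=
  (r + 3) * (\sum_(e in A) w e) by rewrite HT HP; lra.
have := ler_wpM2l (ler0n R n`!) HTT.
lra.
Qed.

End OneCluster.
End Cluster.

(** * Summation over clusters and comparison with the optimal cost *)

Lemma nearest_dist_attained (R : realType) (X : metricType R) (x b : X) (B : seq X) :
  exists2 b', b' \in b :: B & nearest_dist x (b :: B) = (mdist x b')%:E.
Proof.
rewrite /nearest_dist; elim: B b => [|a B IH] b.
  by exists b; rewrite ?mem_head // big_seq1.
have [b' b'B E] := IH a; rewrite big_cons E -EFin_min.
have [_|_] := leP (mdist x b) (mdist x b'); first by exists b; rewrite ?mem_head.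
by exists b' => //; rewrite inE b'B orbT.
Qed.

Lemma COST_ge0 (R : realType) (X : metricType R) (A : seq X) (B : {fset X}) :
  0 <= COST A B.
Proof.
by apply: sumr_ge0 => a _; apply: fine_ge0; exact: nearest_dist_ge0.
Qed.

Section Total.
Context {R : realType} {X : metricType R}.
Variables (f r : R) (h t n : nat) (S : n.-tuple X) (adv : 'S_n -> 'S_n).
Hypotheses (f_gt0 : 0 < f) (r_gt1 : 1 < r) (t_gt0 : (0 < t)%N).
Hypothesis rh_ge4t : 4 * t%:R <= r ^+ h.
Hypothesis adv_bounded : forall p, t_bounded t (adv p).

Definition mean_toll : R := (n`!%:R)^-1 *
  \sum_(p : 'S_n) run_mean f (stream S adv p) (fun W => \sum_i toll f (stream S adv p) W i).

Lemma expected_facility_toll : OFL_expectation f S adv facility_cost = mean_toll.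
Proof.
by congr (_ * _); apply: eq_bigr => p _; rewrite -(run_mean_facility _ f_gt0).
Qed.

Lemma expected_connection_toll : OFL_expectation f S adv connection_cost <= mean_toll.
Proof.
rewrite ler_wpM2l ?invr_ge0 //; apply: ler_sum => p _; exact: run_mean_connection.
Qed.

(** Points are grouped by nearest center and [cluster_bound] is summed over the centers. Either
    alternative provides a center for every point of [S]; the first also allows [B] to be empty when
    [S] is. *)
Lemma mean_toll_le (B : {fset X}) : {subset S <= B} \/ (0 < #|` B|)%N ->
  mean_toll <= (r + 3) * COST S B + (h%:R + 15 / 8) * f * #|` B|%:R.
Proof.
move=> SB.
have nearest e : exists b, b \in B /\
    mdist (tnth S e) b = fine (nearest_dist (tnth S e) B).
  have : (0 < size (enum_fset B))%N.
    case: SB => [/(_ _ (mem_tnth e S)) eB|//].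
    by apply: leq_ltn_trans (_ : index (tnth S e) (enum_fset B) < _)%N; rewrite ?index_mem.
  case E: (enum_fset B) => [//|b B'] _.
  have [b' b'B H] := nearest_dist_attained (tnth S e) b B'.
  by exists b'; rewrite H; split=> //; rewrite -[b' \in B]/(b' \in enum_fset B) E.
have [cl clP] := choice nearest.
pose A b := [set e | cl e == b].
have clE b e : e \in A b -> mdist (tnth S e) b = fine (nearest_dist (tnth S e) B).
  by rewrite inE => /eqP <-; have [_ ->] := clP e.
have split (F : 'I_n -> R) : \sum_e F e = \sum_(b <- B) \sum_(e in A b) F e.
  rewrite (exchange_big_dep xpredT) //=; apply: eq_bigr => e _; rewrite big_mkcond.
  have [eB _] := clP e; rewrite (bigD1_seq (cl e)) ?fset_uniq //=.
  rewrite inE eqxx big1 ?addr0 // => b; rewrite inE eq_sym.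
  by case: eqP.
have -> : (r + 3) * COST S B + (h%:R + 15 / 8) * f * #|` B|%:R =
    \sum_(b <- B) ((r + 3) * (\sum_(e in A b) mdist (tnth S e) b) + (h%:R + 15 / 8) * f).
  rewrite big_split -mulr_sumr /= big_const_seq count_predT iter_addr_0 mulr_natr.
  congr (_ * _ + _); rewrite /COST big_tuple split.
  by apply: eq_bigr => b _; apply: eq_bigr => e /clE.
rewrite /mean_toll ler_pdivrMl ?ltr0n ?fact_gt0 // mulr_sumr.
have -> : \sum_(p : 'S_n) run_mean f (stream S adv p)
      (fun W => \sum_i toll f (stream S adv p) W i) =
    \sum_(b <- B) \sum_(p : 'S_n) run_mean f (stream S adv p)
      (fun W => \sum_(i in (adv p * p)%g @^-1: A b) toll f (stream S adv p) W i).
  rewrite [RHS]exchange_big; apply: eq_bigr => p _; rewrite [RHS]exchange_big /=.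
  apply: eq_bigr => W _; rewrite -mulr_sumr; congr (_ * _).
  rewrite (reindex_inj (@perm_inj _ (adv p * p)^-1%g)) split.
  apply: eq_bigr => b _; rewrite [RHS](reindex_inj (@perm_inj _ (adv p * p)^-1%g)).
  by apply: eq_bigl => e; rewrite !inE permKV.
apply: ler_sum => b _.
exact: (cluster_bound S f_gt0 r_gt1 t_gt0 rh_ge4t adv_bounded b (A b)).
Qed.

End Total.

Theorem theorem1 (R : realType) (X : metricType R) (f : R) (f_gt0 : 0 < f)
    (t : nat) (t_ge1 : (1 <= t)%N) (r : R) (r_gt1 : 1 < r) (h : nat)
    (rh_ge4t : 4 * t%:R <= r ^+ h) (k : nat) (k_gt0 : (0 < k)%N)
    (n : nat) (S : n.-tuple X)
    (adv : 'S_n -> 'S_n) (adv_bounded : forall pi : 'S_n, t_bounded t (adv pi)) :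
  OFL_expectation f S adv facility_cost
    < (r + 3) * OPT k S + (h%:R + 2) * f * k%:R /\
  OFL_expectation f S adv connection_cost
    < (r + 3) * OPT k S + (h%:R + 2) * f * k%:R.
Proof.
suff H : mean_toll f S adv < (r + 3) * OPT k S + (h%:R + 2) * f * k%:R.
  split; first by rewrite expected_facility_toll.
  by apply: le_lt_trans H; exact: expected_connection_toll.
have bound := @mean_toll_le _ _ _ _ _ _ _ S adv f_gt0 r_gt1 t_ge1 rh_ge4t adv_bounded.
have h0 : 0 <= h%:R :> R by [].
have k1 : 1 <= k%:R :> R by rewrite ler1n.
have hf : 0 <= h%:R * f by rewrite mulr_ge0 // ltW.
have fk : f <= f * k%:R by rewrite ler_peMr // ltW.
have [[B0 B0k]|noB] := pselect (exists B : {fset X}, #|` B| = k).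
  have Kinf : has_inf [set COST S B | B in [set B : {fset X} | #|` B| = k]]%classic.
    split; first by exists (COST S B0), B0.
    by exists 0 => _ [B _ <-]; exact: COST_ge0.
  (* The infimum is only approximated: multiplied by [r + 3], this error becomes [f / 16], less than
     the margin [f * k / 8] between [15 / 8] and 2. *)
  have e0 : 0 < f / (16 * (r + 3)) by rewrite divr_gt0 // mulr_gt0 //; lra.
  have [_ [B Bk <-] HB] := inf_adherent e0 Kinf.
  have /bound HB' : {subset S <= B} \/ (0 < #|` B|)%N by right; rewrite Bk.
  apply: (le_lt_trans HB'); rewrite Bk.
  have : (r + 3) * COST S B < (r + 3) * (OPT k S + f / (16 * (r + 3))).
    by rewrite ltr_pM2l //; lra.
  have -> : (r + 3) * (OPT k S + f / (16 * (r + 3))) = (r + 3) * OPT k S + f / 16.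
    by field; lra.
  lra.
(* If no [k]-point set exists, [S] has fewer than [k] distinct points. Taking all of them as centers
   costs 0, and [OPT] takes the default value 0 of the infimum of the empty set. *)
have Bk : (#|` [fset x in tval S]%fset| < k)%N.
  rewrite ltnNge; apply/negP => kB; apply: noB.
  exists [fset x in take k (undup (tval S))]%fset.
  rewrite card_fseq undup_id ?take_uniq ?undup_uniq // size_takel //.
  by rewrite -card_fseq.
have OPT0 : OPT k S = 0.
  rewrite /OPT (_ : [set _ | _ in _]%classic = set0) ?inf0 //.
  by apply/seteqP; split => // y [B BK _]; apply: noB; exists B.
have /bound : {subset S <= [fset x in tval S]%fset} \/ (0 < #|` [fset x in tval S]%fset|)%N.
  by left => x; rewrite !inE.
have -> : COST S [fset x in tval S]%fset = 0.
  apply: big1_seq => a /andP[_ aS].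
  have aB : a \in enum_fset [fset x in tval S]%fset.
    by rewrite -[_ \in _]/(a \in [fset x in tval S]%fset) inE.
  have : (nearest_dist a [fset x in tval S]%fset <= 0)%E.
    have := @ge_bigmin_seq _ _ _ _ +oo%E a xpredT (fun b => (mdist a b)%:E) aB isT.
    by rewrite mdistxx.
  have := nearest_dist_ge0 a (enum_fset [fset x in tval S]%fset).
  move=> n0 n1; suff -> : nearest_dist a [fset x in tval S]%fset = 0%E by [].
  by apply: le_anti; rewrite n0 n1.
rewrite OPT0 !mulr0 !add0r => /le_lt_trans; apply.
have Bk' : #|` [fset x in tval S]%fset|%:R <= k%:R :> R by rewrite ler_nat ltnW.
have : (h%:R + 15 / 8) * f * #|` [fset x in tval S]%fset|%:R <= (h%:R + 15 / 8) * f * k%:R.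
  by rewrite ler_wpM2l // mulr_ge0 ?(ltW f_gt0) // addr_ge0.
lra.
Qed.
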